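(* Let $\tau=2\,\mathrm{Tr}$ on $M_2$. For $\beta\in[0,1]$ and $\gamma,\delta\in\mathbb{C}$ let $\mathcal{G}_{\beta,\gamma,\delta}^{(2)}$ be the quantum graph on $(M_2,\tau)$ with Pauli space $$V_{\beta,\gamma,\delta}^{(2)}=\mathrm{span}\left\{(0,1,i\beta,0)^t,\ (1,i\beta\gamma,\gamma,\delta)^t\right\}\subset\mathbb{C}^4.$$ Let $J^{(2)}$ be the set of triples $(\beta,\gamma,\delta)\in[0,1]\times\mathbb{C}\times\mathbb{C}$ satisfying: - if $\beta=0$ and $\frac{\gamma}{\delta}\neq\pm i$, then $\arg(\gamma)\in[0,\pi)$, $\arg(\delta)=\arg(\gamma)+\pi$ and $|\delta|\le|\gamma|$; - if $\beta=0$ and $\frac{\gamma}{\delta}=\pm i$, then $\gamma\in[0,\infty)$, $\arg(\delta)=\arg(\gamma)+\pi$ and $|\delta|\le\gamma$; - if $\beta\in(0,1)$, then $\arg(\gamma)\in[0,\pi)$; - if $\beta=1$, then $\gamma\in[0,\infty)$. Then any non-loopfree quantum graph $\mathcal{G}$ on $(M_2,\tau)$ with exactly two quantum edges is isomorphic to exactly one of the quantum graphs $\mathcal{G}_{\beta,\gamma,\delta}^{(2)}$ where $(\beta,\gamma,\delta)\in J^{(2)}$.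
   Context: $M_2$ is the algebra of complex $2\times2$ matrices. A quantum graph on $(M_2,\tau)$ is given by its quantum edge space, an arbitrary linear subspace $S\subset M_2$; the number of quantum edges is $\dim S$. It is loopfree if $\mathrm{I}_2\perp S$ with respect to the inner product $\langle x,y\rangle=\frac12\mathrm{Tr}(x^*y)$, and non-loopfree otherwise. Two quantum graphs on $(M_2,\tau)$ with edge spaces $S_1,S_2$ are isomorphic if there is a $*$-automorphism $\pi$ of $M_2$ with $\tau\circ\pi=\tau$ and $\pi(S_1)=S_2$. With the Pauli matrices $\sigma_0=\mathrm{I}_2$, $\sigma_1=\begin{pmatrix}0&1\\1&0\end{pmatrix}$, $\sigma_2=\begin{pmatrix}0&-i\\i&0\end{pmatrix}$, $\sigma_3=\begin{pmatrix}1&0\\0&-1\end{pmatrix}$, the Pauli space of the quantum graph with edge space $S$ is $V=\{(x_0,x_1,x_2,x_3)^t\in\mathbb{C}^4: x_0\sigma_0+x_1\sigma_1+x_2\sigma_2+x_3\sigma_3\in S\}$. $\arg$ denotes the argument of a complex number.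
   Formalization: In both β=0 conditions, arg(δ)=arg(γ)+π is replaced by arg(δ)=arg(γ)+π/2, since with π the claim fails (no parameter gives the graph β=0, γ=1, δ=i); 0 is taken to have every argument, and γ/0 counts as different from ±i. *)

(* Defs.v *)
From HB Require Import structures.
From mathcomp Require Import all_boot all_order all_algebra spectral.
From mathcomp Require Import complex.
From mathcomp Require Import boolp reals trigo.

Set Implicit Arguments.
Unset Strict Implicit.
Unset Printing Implicit Defensive.

Import Order.TTheory GRing.Theory Num.Theory.

Local Open Scope ring_scope.
Local Open Scope complex_scope.
Local Open Scope sesquilinear_scope.

Section QuantumGraphs.
Variable R : realType.
Local Notation C := R[i].

Definition mx2 (a b c d : C) : 'M[C]_2 :=
  \matrix_(j < 2, k < 2) nth 0 (nth [::] [:: [:: a; b]; [:: c; d]] j) k.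

Definition col4 (a b c d : C) : 'cV[C]_4 :=
  \col_(k < 4) nth 0 [:: a; b; c; d] k.

Definition tau (x : 'M[C]_2) : C := 2%:R * \tr x.

Definition inner (x y : 'M[C]_2) : C := 2%:R^-1 * \tr (x ^t* *m y).

(* A quantum graph on (M_2, tau) is identified with its quantum edge space. *)
Definition quantum_graph := {vspace 'M[C]_2}.

Definition num_edges (S : quantum_graph) : nat := \dim S.

Definition loopfree (S : quantum_graph) : Prop :=
  forall x, x \in S -> inner 1%:M x = 0.

Definition star_automorphism (f : 'End('M[C]_2)) : Prop :=
  [/\ bijective f, f 1%:M = 1%:M,
      forall x y, f (x *m y) = f x *m f y
    & forall x, f (x ^t*) = (f x) ^t*].

Definition isomorphic (S1 S2 : quantum_graph) : Prop :=
  exists f : 'End('M[C]_2),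
    [/\ star_automorphism f, forall x, tau (f x) = tau x & (f @: S1)%VS = S2].

Definition pauli (k : 'I_4) : 'M[C]_2 :=
  nth 0 [:: mx2 1 0 0 1; mx2 0 1 1 0; mx2 0 (- 'i%C) 'i%C 0; mx2 1 0 0 (- 1)] k.

Definition pauli_comb (x : 'cV[C]_4) : 'M[C]_2 := \sum_(k < 4) x k 0 *: pauli k.

Fact pauli_comb_linear : linear pauli_comb.
Proof.
move=> a x y; rewrite /pauli_comb scaler_sumr -big_split /=.
by apply: eq_bigr => k _; rewrite !mxE scalerDl scalerA.
Qed.

HB.instance Definition _ :=
  GRing.isLinear.Build C 'cV[C]_4 'M[C]_2 _ pauli_comb pauli_comb_linear.

Definition pauli_space (S : quantum_graph) : {vspace 'cV[C]_4} :=
  (linfun pauli_comb @^-1: S)%VS.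

Lemma mem_pauli_space S x : (x \in pauli_space S) = (pauli_comb x \in S).
Proof. by rewrite -memv_preim lfunE. Qed.

Definition V2 (beta : R) (gamma delta : C) : {vspace 'cV[C]_4} :=
  <<[:: col4 0 1 ('i%C * beta%:C) 0;
        col4 1 ('i%C * beta%:C * gamma) gamma delta]%R>>%VS.

Definition G2 (beta : R) (gamma delta : C) : quantum_graph :=
  (linfun pauli_comb @: V2 beta gamma delta)%VS.

Lemma pauli_comb_inj : injective pauli_comb.
Proof.
apply: raddf_inj => x /=.
have -> : pauli_comb x = \sum_(k < 4) x k 0 *: pauli k by [].
have i2 : 'i%C * 'i%C = - 1 :> C by rewrite -expr2 sqr_i.
rewrite 4!big_ord_recl big_ord0 addr0 => /matrixP e.
have := (e 0 0, e 0 1, e 1 0, e 1 1); rewrite !mxE /= !mulr0 !mulr1 !add0r.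
rewrite !addr0 !mulrN !mulr1.
set x0 := x 0 0; set x1 := x (lift _ (lift _ (lift _ _))) _.
set x2 := x (lift _ _) _; set x3 := x _ _.
move=> [[[h00 h01] h10] h11].
have dbl (z : C) : z + z = 0 -> z = 0.
  by move/eqP; rewrite -mulr2n mulrn_eq0 /= => /eqP.
have z0 : x0 = 0.
  by apply: dbl; rewrite -[RHS](addr0 0) -{1}h00 -h11 addrACA subrr addr0.
have z2 : x2 = 0.
  by apply: dbl; rewrite -[RHS](addr0 0) -{1}h01 -h10 addrACA addNr addr0.
have z1 : x1 = 0 by move: h00; rewrite z0 add0r.
have z3 : x3 = 0.
  move: h10; rewrite z2 add0r => /eqP; rewrite mulf_eq0 => /orP[/eqP //|].
  by move/eqP => i0; move/eqP: i2; rewrite i0 mul0r eq_sym oppr_eq0 oner_eq0.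
apply/colP => k; rewrite mxE.
case: k => [[|[|[|[|//]]]] hk]; [rewrite -z0|rewrite -z2|rewrite -z3|rewrite -z1];
  by congr (x _ _); apply: val_inj.
Qed.

Lemma pauli_space_G2 beta gamma delta :
  pauli_space (G2 beta gamma delta) = V2 beta gamma delta.
Proof.
apply/vspaceP => x; rewrite mem_pauli_space -(lfunE pauli_comb).
apply/memv_imgP/idP => [[y yV]|xV]; last by exists x.
by rewrite !lfunE => /pauli_comb_inj ->.
Qed.

(* t is one of the (mod 2 pi) arguments of z; every t is an argument of 0, so
   that conditions on arg z impose nothing on the direction of z = 0. *)
Definition is_arg (z : C) (t : R) : Prop := z = `|z| * (cos t +i* sin t).

(* The offset between arg gamma and arg delta is pi / 2. An offset of pi, as
   printed in the source, is incompatible with gamma / delta = 'i or - 'i; with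
   it, no parameter at all would be isomorphic to G2 0 1 'i, while
   G2 0 (4 / 5) (- 3 / 5) and G2 0 (12 / 13) (- 5 / 13) would be isomorphic
   members. When delta = 0 the quotient is 0, hence neither 'i nor - 'i. *)
Definition J2 (beta : R) (gamma delta : C) : Prop :=
  [/\ 0 <= beta <= 1,
      beta = 0 -> ~ (gamma / delta = 'i%C \/ gamma / delta = - 'i%C) ->
        (exists t : R, [/\ 0 <= t < pi, is_arg gamma t
                         & is_arg delta (t + pi / 2)])
        /\ `|delta| <= `|gamma|,
      beta = 0 -> (gamma / delta = 'i%C \/ gamma / delta = - 'i%C) ->
        [/\ 0 <= gamma,
            exists t : R, is_arg gamma t /\ is_arg delta (t + pi / 2)
          & `|delta| <= gamma],
      0 < beta < 1 -> exists2 t : R, 0 <= t < pi & is_arg gamma t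
    & beta = 1 -> 0 <= gamma].

End QuantumGraphs.

(* Main.v *)
Require Import Defs.
From mathcomp Require Import all_boot all_order all_algebra.
From mathcomp Require Import complex reals.
From HB Require Import structures.
From mathcomp Require Import boolp trigo spectral ring lra.

Set Implicit Arguments.
Unset Strict Implicit.
Unset Printing Implicit Defensive.
Import Order.TTheory GRing.Theory Num.Theory.

(** In Pauli coordinates a trace-preserving *-automorphism fixes the identity
  and rotates C^3 by an element of SO(3).  A non-loopfree space of dimension two
  is spanned by a traceless X, unique up to a scalar, and the unique Y of trace
  two orthogonal to X.  Multiplying X by a phase makes the trace of X^2
  nonnegative, that is, makes the real and imaginary parts of its Pauli vector
  orthogonal with the real part at least as long; rotating them to the first two
  axes gives (0, 1, i beta, 0).  The rotations that preserve this line are then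
  used to normalise Y: all planar rotations and reflections if beta = 0, a half
  turn if 0 < beta < 1, all rotations about the third axis if beta = 1.
  Conversely the parameters are recovered from the traces of X^* X, X^2, X Y,
  X^* X Y, Y^* Y and Y^2, up to the scalar by which the automorphism acts on
  X. *)

Section Pauli.
Local Open Scope ring_scope.
Local Open Scope sesquilinear_scope.
Variable R : realType.
Local Notation C := (R[i])%C.
Local Notation ii := (@Complex R 0 1).
Local Notation rc := (@real_complex_def R (Phant R)).
Local Notation Re := complex.Re.
Local Notation Im := complex.Im.
Local Notation cis t := (Complex (cos t) (sin t)).

(** * Pauli coordinates *)

Lemma mulii : ii * ii = -1 :> C.
Proof. by rewrite -expr2 sqr_i. Qed.

Lemma conj_ii : ii^* = - ii :> C.
Proof. by apply/eqP; rewrite eq_complex /= oppr0 !eqxx. Qed.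

Lemma ii_neq0 : ii != 0 :> C.
Proof. by rewrite eq_complex /= oner_eq0 andbF. Qed.

Lemma norm_ii : `|ii| = 1 :> C.
Proof.
apply/eqP; rewrite -(@eqrXn2 _ 2%N) ?normr_ge0 ?ler01 //.
by rewrite -normrX sqr_i normrN1 expr1n.
Qed.

Definition pm (a b c d : C) : 'M[C]_2 := pauli_comb (col4 a b c d).

Lemma pmE a b c d :
  pm a b c d = mx2 (a + d) (b - ii * c) (b + ii * c) (a - d).
Proof.
rewrite /pm /pauli_comb 4!big_ord_recl big_ord0 addr0.
apply/matrixP => -[[|[|//]] ?] [[|[|//]] ?]; rewrite !mxE /=; ring.
Qed.

(** For vector parts $x,y$ the product has scalar part $x\cdot y$, bilinear and without conjugation,
    and vector part $i\,x\times y$. *)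
Lemma mulmx_pm a b c d a' b' c' d' :
  pm a b c d *m pm a' b' c' d' =
  pm (a * a' + b * b' + c * c' + d * d')
     (a * b' + b * a' + ii * (c * d' - d * c'))
     (a * c' + c * a' + ii * (d * b' - b * d'))
     (a * d' + d * a' + ii * (b * c' - c * b')).
Proof.
rewrite !pmE; apply/matrixP => -[[|[|//]] ?] [[|[|//]] ?];
  rewrite !mxE !big_ord_recl big_ord0 !mxE /=; ring: mulii.
Qed.

Lemma adjmx_pm a b c d : (pm a b c d)^t* = pm a^* b^* c^* d^*.
Proof.
rewrite !pmE; apply/matrixP => -[[|[|//]] ?] [[|[|//]] ?];
  rewrite !mxE /= !(rmorphD, rmorphN, rmorphM) /= ?conj_ii; ring.
Qed.

Lemma mxtrace_pm a b c d : \tr (pm a b c d) = 2 * a.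
Proof. rewrite pmE /mxtrace !big_ord_recl big_ord0 !mxE /=; ring. Qed.

Lemma pm_surj M : exists a b c d, M = pm a b c d.
Proof.
(* The coordinates are the half traces $\frac12\mathrm{Tr}(\sigma_k M)$. *)
exists ((M 0 0 + M 1 1) / 2), ((M 0 1 + M 1 0) / 2),
  (ii * (M 0 1 - M 1 0) / 2), ((M 0 0 - M 1 1) / 2).
have -> : M = mx2 (M 0 0) (M 0 1) (M 1 0) (M 1 1).
  apply/matrixP => -[[|[|//]] p] [[|[|//]] q]; rewrite !mxE /=;
  by congr (M _ _); apply: val_inj.
rewrite pmE; apply/matrixP => -[[|[|//]] p] [[|[|//]] q]; rewrite !mxE /=;
  field: mulii; rewrite ?pnatr_eq0 //.
Qed.

Lemma pm1 : pm 1 0 0 0 = 1%:M.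
Proof.
by rewrite pmE; apply/matrixP => -[[|[|//]] ?] [[|[|//]] ?]; rewrite !mxE /=;
  ring.
Qed.

(** * Automorphisms of M_2 from orthonormal frames *)

Lemma isomorphism_inv f : star_automorphism f ->
    (forall x : 'M[C]_2, tau (f x) = tau x) ->
  [/\ star_automorphism f^-1%VF, forall x, tau (f^-1%VF x) = tau x,
      cancel f f^-1%VF & cancel f^-1%VF f].
Proof.
move=> [fbij f1 fM fS] ft.
have kerf : lker f == 0%VS by apply/lker0P; apply: bij_inj.
have fK := lker0_lfunK kerf; have Kf := lker0_lfunVK kerf.
split=> //; last by move=> x; rewrite -ft Kf.
split; first by exists f.
- by apply: (bij_inj fbij); rewrite Kf f1.
- by move=> x y; apply: (bij_inj fbij); rewrite fM !Kf.
- by move=> x; apply: (bij_inj fbij); rewrite fS !Kf.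
Qed.

Lemma isomorphic_sym (S T : quantum_graph R) :
  isomorphic S T -> isomorphic T S.
Proof.
move=> [f [fa ft <-]]; have [ga gt fK _] := isomorphism_inv fa ft.
exists f^-1%VF; split=> //.
rewrite -limg_comp -[RHS]lim1g; congr (_ @: _)%VS.
by apply/lfunP=> x; rewrite !lfunE /= fK.
Qed.

Lemma isomorphic_trans (S T U : quantum_graph R) :
  isomorphic S T -> isomorphic T U -> isomorphic S U.
Proof.
move=> [f [[fb f1 fM fS] ft <-]] [g [[gb g1 gM gS] gt <-]].
exists (g \o f)%VF; split; last by rewrite limg_comp.
- split.
  + apply: (@eq_bij _ _ (g \o f)); first exact: bij_comp.
    by move=> x; rewrite lfunE.
  + by rewrite lfunE /= f1.
  + by move=> x y; rewrite !lfunE /= fM gM.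
  + by move=> x; rewrite !lfunE /= fS gS.
- by move=> x; rewrite lfunE /= gt ft.
Qed.

(* [A], [B] and [D] are the prospective images of the three Pauli matrices. *)
Section Frame.
Variables A B D : 'M[C]_2.
Hypotheses (adjA : A^t* = A) (adjB : B^t* = B).
Hypotheses (sqA : A *m A = 1%:M) (sqB : B *m B = 1%:M).
Hypothesis antiAB : B *m A = - (A *m B).
Hypothesis defD : D = - ii *: (A *m B).

Definition frame_fun (M : 'M[C]_2) : 'M[C]_2 :=
  ((M 0 0 + M 1 1) / 2) *: 1%:M + ((M 0 1 + M 1 0) / 2) *: A +
  (ii * (M 0 1 - M 1 0) / 2) *: B + ((M 0 0 - M 1 1) / 2) *: D.

Lemma frame_fun_linear : linear frame_fun.
Proof.
by move=> k x y; apply/matrixP=> i j; rewrite /frame_fun !mxE; ring.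
Qed.

HB.instance Definition _ :=
  GRing.isLinear.Build C 'M[C]_2 'M[C]_2 _ frame_fun frame_fun_linear.

Lemma frame_fun_pm a b c d :
  frame_fun (pm a b c d) = a *: 1%:M + b *: A + c *: B + d *: D.
Proof.
rewrite /frame_fun pmE !mxE /=.
have two0 : (2 : C) != 0 by rewrite pnatr_eq0.
move: ii mulii two0 => im im2 two0.
have -> : (a + d + (a - d)) / 2 = a by field.
have -> : (b - im * c + (b + im * c)) / 2 = b by field.
have -> : im * (b - im * c - (b + im * c)) / 2 = c by field: im2.
by have -> : (a + d - (a - d)) / 2 = d by field.
Qed.

Lemma mulADE : A *m D = - ii *: B.
Proof. by rewrite defD -scalemxAr mulmxA sqA mul1mx. Qed.

Lemma mulDAE : D *m A = ii *: B.
Proof.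
by rewrite defD -scalemxAl -mulmxA antiAB mulmxN mulmxA sqA mul1mx
  scaleNr scalerN opprK.
Qed.

Lemma mulBDE : B *m D = ii *: A.
Proof.
by rewrite defD -scalemxAr mulmxA antiAB mulNmx -mulmxA sqB mulmx1
  scaleNr scalerN opprK.
Qed.

Lemma mulDBE : D *m B = - ii *: A.
Proof. by rewrite defD -scalemxAl -mulmxA sqB mulmx1. Qed.

Lemma mulABE : A *m B = ii *: D.
Proof. by rewrite defD scalerA mulrN mulii opprK scale1r. Qed.

Lemma mulBAE : B *m A = - ii *: D.
Proof. by rewrite antiAB mulABE scaleNr. Qed.

Lemma mulDDE : D *m D = 1%:M.
Proof.
by rewrite {2}defD -scalemxAr mulmxA mulDAE -scalemxAl scalerA sqB mulNr
  mulii opprK scale1r.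
Qed.

Lemma adjDE : D^t* = D.
Proof.
rewrite defD linearZ /= map_mxZ /= trmx_mul map_mxM adjA adjB antiAB.
by rewrite rmorphN /= conj_ii opprK scalerN scaleNr.
Qed.

(** Since [D] mirrors $\sigma_3=-i\sigma_1\sigma_2$, the triple obeys the whole Pauli multiplication
    table. After the products are rewritten, both sides are linear in [1], [A], [B], [D] and are
    compared entrywise. *)
Lemma frame_funM x y : frame_fun (x *m y) = frame_fun x *m frame_fun y.
Proof.
have [a [b [c [d ->]]]] := pm_surj x; have [a' [b' [c' [d' ->]]]] := pm_surj y.
rewrite mulmx_pm !frame_fun_pm !mulmxDl !mulmxDr -!(scalemxAl, scalemxAr).
rewrite !(mul1mx, mulmx1) sqA sqB mulDDE mulADE mulDAE mulBDE mulDBE mulABE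
  mulBAE.
have addE (M N : 'M[C]_2) i j : (M + N) i j = M i j + N i j by rewrite mxE.
have scaleE k (M : 'M[C]_2) i j : (k *: M) i j = k * M i j by rewrite mxE.
apply/matrixP=> i j; rewrite !scalerA !addE !scaleE.
move: (A i j) (B i j) (D i j) (_%:M i j) ii mulii => Aij Bij Dij Iij im im2;
  ring: im2.
Qed.

Lemma frame_funS x : frame_fun (x^t*) = (frame_fun x)^t*.
Proof.
have [a [b [c [d ->]]]] := pm_surj x; rewrite adjmx_pm !frame_fun_pm.
rewrite !linearD !linearZ /= !map_mxD !map_mxZ /= adjA adjB adjDE.
by rewrite trmx1 map_mx1.
Qed.

(** Only the identity contributes: conjugating [A] by the involution [B] gives [- A], so
    $\mathrm{Tr}\,A=0$, likewise for [B], and $\mathrm{Tr}(AB)=\mathrm{Tr}(BA)=-\mathrm{Tr}(AB)$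
    handles [D]. *)
Lemma tau_frame_fun x : tau (frame_fun x) = tau x.
Proof.
have [a [b [c [d ->]]]] := pm_surj x; rewrite frame_fun_pm /tau mxtrace_pm.
rewrite !linearD !linearZ /= mxtrace1.
have eqN0 (z : C) : z = - z -> z = 0.
  by move/eqP; rewrite -subr_eq0 opprK -mulr2n mulrn_eq0 /= => /eqP.
have -> : \tr A = 0.
  apply: eqN0; rewrite -[in LHS](mulmx1 A) -sqB mulmxA mxtrace_mulC mulmxA
    antiAB.
  by rewrite mulNmx -mulmxA sqB mulmx1 linearN.
have -> : \tr B = 0.
  apply: eqN0; rewrite -[in LHS](mul1mx B) -sqA -mulmxA mxtrace_mulC -mulmxA
    antiAB.
  by rewrite mulmxN mulmxA sqA mul1mx linearN.
have -> : \tr D = 0.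
  by rewrite defD linearZ /= (eqN0 (\tr _)) ?mulr0 // -linearN -antiAB
    mxtrace_mulC.
ring.
Qed.

(** The trace form is nondegenerate: for [x] in the kernel, multiplicativity and trace preservation
    give $\mathrm{Tr}(xy)=0$ for all [y], and testing on the Pauli matrices kills every
    coordinate. *)
Lemma frame_fun_inj : injective frame_fun.
Proof.
apply: raddf_inj => x x0.
have tr0 y : \tr (x *m y) = 0.
  have : tau (x *m y) = 0 by rewrite -tau_frame_fun frame_funM x0 mul0mx /tau
    linear0 mulr0.
  by move/eqP; rewrite mulf_eq0 pnatr_eq0 => /eqP.
have [a [b [c [d xE]]]] := pm_surj x; move: (tr0); rewrite xE => {}tr0.
have z0 (z : C) : 2 * z = 0 -> z = 0.
  by move/eqP; rewrite mulf_eq0 pnatr_eq0 => /eqP.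
have := (tr0 (pm 1 0 0 0), tr0 (pm 0 1 0 0), tr0 (pm 0 0 1 0), tr0 (pm 0 0 0
  1)).
rewrite !mulmx_pm !mxtrace_pm !mulr0 !mulr1 !addr0 !add0r.
move=> [[[/z0-> /z0->] /z0->] /z0->].
by rewrite pmE; apply/matrixP => -[[|[|//]] ?] [[|[|//]] ?]; rewrite !mxE /=;
  ring.
Qed.

Lemma frame_automorphism : exists f : 'End('M[C]_2),
  [/\ star_automorphism f, forall x, tau (f x) = tau x
    & forall a b c d,
        f (pm a b c d) = a *: 1%:M + b *: A + c *: B + d *: D].
Proof.
exists (linfun frame_fun).
split; [split | |] => [||x y|x|x|a b c d]; rewrite ?lfunE.
- have kerf : lker (linfun frame_fun) == 0%VS.
    by apply/lker0P => x y; rewrite !lfunE; apply: frame_fun_inj.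
  exists (linfun frame_fun)^-1%VF; [exact: lker0_lfunK | exact: lker0_lfunVK].
- by rewrite -[in LHS]pm1 /= frame_fun_pm scale1r !scale0r !addr0.
- by rewrite /= frame_funM.
- by rewrite /= frame_funS.
- exact: tau_frame_fun.
- exact: frame_fun_pm.
Qed.

End Frame.

(** * Spans and generators of the standard graphs *)

Lemma G2E beta gamma delta : G2 beta gamma delta =
  <<[:: pm 0 1 (ii * rc beta) 0;
        pm 1 (ii * rc beta * gamma) gamma delta]%R>>%VS.
Proof. by rewrite /G2 /V2 limg_span /= !lfunE. Qed.

Lemma scale_pm (k a b c d : C) :
  k *: pm a b c d = pm (k * a) (k * b) (k * c) (k * d).
Proof.
by rewrite !pmE; apply/matrixP => -[[|[|//]] ?] [[|[|//]] ?]; rewrite !mxE /=;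
  ring.
Qed.

Lemma add_pm (a b c d a' b' c' d' : C) :
  pm a b c d + pm a' b' c' d' = pm (a + a') (b + b') (c + c') (d + d').
Proof.
by rewrite !pmE; apply/matrixP => -[[|[|//]] ?] [[|[|//]] ?]; rewrite !mxE /=;
  ring.
Qed.

Lemma conj_rc (b : R) : Num.conj (rc b) = rc b.
Proof. exact: conjc_real. Qed.

Lemma mem_span2 (u v x : 'M[C]_2) :
  reflect (exists k l, x = k *: u + l *: v) (x \in <<[:: u; v]>>%VS).
Proof.
rewrite span_cons span_seq1; apply: (iffP idP) => [/memv_addP|[k [l ->]]].
  by move=> [_ /vlineP[k ->] [_ /vlineP[l ->] ->]]; exists k, l.
by apply: memv_add; apply/vlineP; [exists k | exists l].
Qed.

Lemma tau_mxtrace (x y : 'M[C]_2) : tau x = tau y -> \tr x = \tr y.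
Proof. by apply: mulfI; rewrite pnatr_eq0. Qed.

Lemma real_sqr1_neq0 (b : R) : 1 + rc b * rc b != 0 :> C.
Proof.
rewrite -rmorphM -(rmorph1 (real_complex R)) -rmorphD /= -(rmorph0
  (real_complex R)).
rewrite (inj_eq (@complexI R)); apply: lt0r_neq0.
by rewrite ltr_pwDl ?ltr01 // -expr2 sqr_ge0.
Qed.

(** * Trace invariants *)

(** The traceless line and the trace-two element orthogonal to it are intrinsic to the edge space,
    so an isomorphism carries them to their counterparts. *)
Lemma G2_isomorphism (b b' : R) (g d g' d' : C) :
    isomorphic (G2 b g d) (G2 b' g' d') ->
  exists f : 'End('M[C]_2), exists k,
  [/\ star_automorphism f, forall x, \tr (f x) = \tr x, k != 0,
      f (pm 0 1 (ii * rc b) 0) = pm 0 k (k * (ii * rc b')) 0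
    & f (pm 1 (ii * rc b * g) g d) = pm 1 (ii * rc b' * g') g' d'].
Proof.
move=> [f [fa ftau fG]]; have [fb f1 fM fS] := fa.
have ftr x : \tr (f x) = \tr x by apply: tau_mxtrace.
set X := pm 0 1 (ii * rc b) 0; set Y := pm 1 (ii * rc b * g) g d.
have fmem x : x \in G2 b g d -> f x \in G2 b' g' d'.
  by rewrite -fG; exact: memv_img.
have XG : X \in G2 b g d.
  by rewrite G2E; apply/mem_span2; exists 1, 0; rewrite scale1r scale0r addr0.
have YG : Y \in G2 b g d.
  by rewrite G2E; apply/mem_span2; exists 0, 1; rewrite scale1r scale0r add0r.
have := fmem _ XG; have := fmem _ YG; rewrite !G2E.
move=> /mem_span2[m [n fY]] /mem_span2[k [l fX]].
have two0 : (2 : C) != 0 by rewrite pnatr_eq0.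
have l0 : l = 0.
  have := ftr X; rewrite fX !(scale_pm, add_pm, mxtrace_pm) => /(mulfI two0).
  by rewrite mulr0 add0r mulr1.
have n1 : n = 1.
  have := ftr Y; rewrite fY !(scale_pm, add_pm, mxtrace_pm) => /(mulfI two0).
  by rewrite mulr0 add0r mulr1.
move: fX fY; rewrite l0 n1 scale0r addr0 scale1r => fX fY.
(* Otherwise $X^*X$, of trace $2(1+b^2)$, would have an image of trace zero. *)
have k0 : k != 0.
  apply/eqP => k0; have := ftr (X^t* *m X).
  rewrite fM fS fX k0 scale0r mulmx0 linear0 adjmx_pm mulmx_pm mxtrace_pm =>
    /esym.
  move/eqP; rewrite mulf_eq0 (negPf two0) !rmorphM /= conj_ii conj_rc ?conjC1
    !mulr0 add0r mulr1 addr0.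
  suff -> : 1 + - ii * rc b * (ii * rc b) = 1 + rc b * rc b :> C.
    by rewrite (negPf (real_sqr1_neq0 b)).
  by ring: mulii.
(* [X] and [Y] are orthogonal, whereas the images have half trace $\bar k\,m\,(1+b'^2)$. *)
have m0 : m = 0.
  have := ftr (X^t* *m Y).
  rewrite fM fS fX fY !(scale_pm, add_pm, adjmx_pm, mulmx_pm, mxtrace_pm).
  move/(mulfI two0); rewrite !rmorphM /= !conj_ii !conj_rc ?conjC0 ?conjC1.
  have -> (x : C) : 0 * 1 + 1 * (ii * rc b * g) + - ii * rc b * g + x * d = x *
    d by ring.
  rewrite mul0r => e; have : k^* * (1 + rc b' * rc b') * m = 0.
    by rewrite -e; ring: mulii.
  move/eqP; rewrite mulf_eq0 mulf_eq0 conjC_eq0 (negPf k0) (negPf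
    (real_sqr1_neq0 b')).
  by move/eqP.
exists f, k; split=> //; first by rewrite fX scale_pm !mulr0 mulr1.
by rewrite fY m0 scale0r add0r.
Qed.

(* [k] is the factor by which the isomorphism rescales the traceless
   generator. *)
Lemma G2_invariants (b b' : R) (g d g' d' : C) :
    0 <= b <= 1 -> 0 <= b' <= 1 -> isomorphic (G2 b g d) (G2 b' g' d') ->
  b = b' /\ exists k,
  [/\ `|k| = 1, (1 - rc b ^+ 2) = k ^+ 2 * (1 - rc b ^+ 2),
      rc b * g = k * rc b * g', rc b * d = rc b * d' &
      `|g| ^+ 2 * (1 + rc b ^+ 2) + `|d| ^+ 2 =
      `|g'| ^+ 2 * (1 + rc b ^+ 2) + `|d'| ^+ 2 /\
      g ^+ 2 * (1 - rc b ^+ 2) + d ^+ 2 =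
      g' ^+ 2 * (1 - rc b ^+ 2) + d' ^+ 2].
Proof.
move=> /andP[b0 b1] /andP[b'0 b'1] /G2_isomorphism[f [k []]].
set X := pm 0 1 (ii * rc b) 0; set Y := pm 1 (ii * rc b * g) g d.
move=> [_ f1 fM fS] ftr k0 fX fY.
have two0 : (2 : C) != 0 by rewrite pnatr_eq0.
have iib0 : 2 * ii != 0 :> C.
  by rewrite mulf_neq0 // ii_neq0.
have e1 : 1 + rc b ^+ 2 = `|k| ^+ 2 * (1 + rc b' ^+ 2).
  have := ftr (X^t* *m X).
  rewrite fM fS fX !(adjmx_pm, mulmx_pm, mxtrace_pm) !rmorphM /= !conj_ii
    !conj_rc ?conjC0 ?conjC1.
  move/(mulfI two0) => e; rewrite normCK; move: e.
  set u := LHS; set v := RHS; move=> e.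
  have -> : 1 + rc b ^+ 2 = v by rewrite /v; ring: mulii.
  by rewrite -e /u; ring: mulii.
have e2 : 1 - rc b ^+ 2 = k ^+ 2 * (1 - rc b' ^+ 2).
  have := ftr (X *m X).
  rewrite fM fX !(adjmx_pm, mulmx_pm, mxtrace_pm).
  move/(mulfI two0).
  set u := LHS; set v := RHS; move=> e.
  have -> : 1 - rc b ^+ 2 = v by rewrite /v; ring: mulii.
  by rewrite -e /u; ring: mulii.
have e3 : rc b * g = k * rc b' * g'.
  have := ftr (X *m Y).
  rewrite fM fX fY !(adjmx_pm, mulmx_pm, mxtrace_pm).
  move/(mulfI two0) => e; apply: (mulfI iib0); move: e.
  set u := LHS; set v := RHS; move=> e.
  have -> : 2 * ii * (rc b * g) = v by rewrite /v; ring: mulii.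
  by rewrite -e /u; ring: mulii.
have e4 : `|g| ^+ 2 * (1 + rc b ^+ 2) + `|d| ^+ 2 =
      `|g'| ^+ 2 * (1 + rc b' ^+ 2) + `|d'| ^+ 2.
  have := ftr (Y^t* *m Y).
  rewrite fM fS fY !(adjmx_pm, mulmx_pm, mxtrace_pm).
  rewrite !rmorphM /= !conj_ii !conj_rc ?conjC1.
  move/(mulfI two0) => e; apply: (addrI 1); rewrite !normCK; move: e.
  set u := LHS; set v := RHS; move=> e.
  transitivity v; first by rewrite /v; ring: mulii.
  by rewrite -e /u; ring: mulii.
have e5 : g ^+ 2 * (1 - rc b ^+ 2) + d ^+ 2 =
      g' ^+ 2 * (1 - rc b' ^+ 2) + d' ^+ 2.
  have := ftr (Y *m Y).
  rewrite fM fY !(adjmx_pm, mulmx_pm, mxtrace_pm).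
  move/(mulfI two0) => e; apply: (addrI 1); move: e.
  set u := LHS; set v := RHS; move=> e.
  transitivity v; first by rewrite /v; ring: mulii.
  by rewrite -e /u; ring: mulii.
(* Absolute values in [e2]; both $1-b^2$ and $1-b'^2$ are nonnegative. Adding [e1] then gives
   $|k|=1$. *)
have e2n : 1 - rc b ^+ 2 = `|k| ^+ 2 * (1 - rc b' ^+ 2).
  have pos (x : R) : 0 <= x -> x <= 1 -> `|1 - rc x ^+ 2| = 1 - rc x ^+ 2 :> C.
    move=> x0 x1; apply: ger0_norm.
    by rewrite subr_ge0 exprn_ile1 // ?ler0c // (lecR x 1).
  by rewrite -[LHS]pos // e2 normrM normrX pos.
have k2 : `|k| ^+ 2 = 1.
  apply: (mulfI two0); rewrite mulr1.
  transitivity ((1 + rc b ^+ 2) + (1 - rc b ^+ 2)); last by ring.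
  by rewrite e1 e2n; ring.
have kn : `|k| = 1.
  by apply/eqP; rewrite -(@eqrXn2 _ 2%N) ?expr1n ?k2 ?normr_ge0 ?ler01.
have bb : b = b'.
  move: e1; rewrite k2 mul1r => /addrI; rewrite -!rmorphXn => /complexI/eqP.
  by rewrite eqrXn2 // => /eqP.
split=> //; subst b'; exists k; split=> //.
(* Half the trace of $X^*XY$ is $1+b^2-2bd$, and the image only gains the factor $|k|^2=1$; this
   isolates $bd$. *)
have := ftr (X^t* *m X *m Y).
rewrite !fM fS fX fY !(adjmx_pm, mulmx_pm, mxtrace_pm) !rmorphM /= !conj_ii
  !conj_rc ?conjC0 ?conjC1.
move/(mulfI two0); rewrite normCK in k2.
set u := LHS; set v := RHS; move=> e.
apply: (mulfI two0); apply: oppr_inj; apply: (addrI (1 + rc b ^+ 2)).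
transitivity v; first by rewrite /v; ring: mulii.
rewrite -e; transitivity (k * k^* * (1 + rc b ^+ 2 - 2 * (rc b * d'))).
  by rewrite /u; ring: mulii.
by rewrite k2 mul1r.
Qed.


(** * Uniqueness of the parameters *)

Lemma norm_cis (t : R) : `|cis t| = 1 :> C.
Proof.
have := add_Re2_Im2 (cis t); rewrite /= cos2Dsin2 => e.
by apply/eqP; rewrite -(@eqrXn2 _ 2%N) ?expr1n ?normr_ge0 ?ler01 // -e.
Qed.

Lemma cisDpihalf (t : R) : cis (t + pi / 2) = ii * cis t.
Proof.
by rewrite cosDpihalf sinDpihalf; apply/eqP; rewrite eq_complex /=;
  apply/andP; split; apply/eqP; ring.
Qed.

(** Equal squares leave a sign. With the minus sign the two sines, both nonnegative, are opposite,
    so both vanish and both angles are zero. *)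
Lemma cis_sqr_inj (t t' : R) : 0 <= t < pi -> 0 <= t' < pi ->
  cis t ^+ 2 = cis t' ^+ 2 -> cis t = cis t'.
Proof.
have sin0 (x : R) : 0 <= x < pi -> sin x = 0 -> x = 0.
  move=> /andP[x0 xpi] sx0; apply/eqP; rewrite eq_sym eq_le x0 leNgt.
  by apply/negP => xgt; have := @sin_gt0_pi _ x;
    rewrite xgt xpi sx0 ltxx => /(_ isT).
move=> tI t'I /eqP; rewrite eqf_sqr => /orP[/eqP //|/eqP[ec es]].
have s_ge0 (x : R) : 0 <= x < pi -> 0 <= sin x.
  by move=> /andP[x0 xpi]; rewrite sin_ge0_pi // x0 ltW.
have st : sin t = 0.
  by apply/eqP; rewrite eq_le s_ge0 // es oppr_le0 s_ge0.
have st' : sin t' = 0 by apply: oppr_inj; rewrite -es st oppr0.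
by rewrite (sin0 t) // (sin0 t').
Qed.

Lemma is_arg_opp_eq (g g' : C) (t t' : R) : 0 <= t < pi -> 0 <= t' < pi ->
  is_arg g t -> is_arg g' t' -> g ^+ 2 = g' ^+ 2 -> g = g'.
Proof.
move=> tI t'I gt g't' e.
have en : `|g| = `|g'|.
  by apply/eqP; rewrite -(@eqrXn2 _ 2%N) ?normr_ge0 // -!normrX e.
have [g0|g0] := eqVneq g 0.
  by apply/esym/eqP; rewrite g0 -normr_eq0 -en g0 normr0.
rewrite gt g't' -en; congr (_ * _); apply: cis_sqr_inj => //.
move: e; rewrite {1}gt g't' -en !exprMn; apply: mulfI.
by rewrite expf_neq0 // normr_eq0.
Qed.

(** Merges the two clauses for $\beta=0$: for nonzero [g], the ratio $\pm i$ occurs exactly when the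
    moduli agree. *)
Lemma J2_0 (g d : C) : J2 (0 : R) g d -> exists t : R,
  [/\ g = `|g| * cis t, d = `|d| * (ii * cis t), `|d| <= `|g|,
      `|g| = `|d| -> 0 <= g & `|g| != `|d| -> 0 <= t < pi].
Proof.
move=> [_ generic iso _ _].
have [r|r] := EM (g / d = ii \/ g / d = - ii).
  have [g0 [t [gt dt]] le] := iso erefl r; exists t.
  split=> //; first by rewrite -cisDpihalf.
    by rewrite (ger0_norm g0).
  move/eqP; case.
  have n1 : `|g / d| = 1.
    by case: r => ->; rewrite ?normrN norm_ii.
  have d0 : d != 0.
    by apply/eqP => d0; move: n1; rewrite d0 invr0 mulr0 normr0 => /esym/eqP;
      rewrite oner_eq0.
  by rewrite -[g](divfK d0) normrM n1 mul1r.
have [[t [tI gt dt]] le] := generic erefl r; exists t.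
have gE : g = `|g| * cis t by [].
have dE : d = `|d| * (ii * cis t) by rewrite -cisDpihalf.
split=> // e; have [->|g0] := eqVneq g 0; first exact: lexx.
case: r; right.
have d0 : `|d| != 0 by rewrite -e normr_eq0.
have c0 : cis t != 0 by rewrite -normr_eq0 norm_cis oner_eq0.
rewrite gE dE e.
by move: (cis t) ii mulii c0 ii_neq0 => u im im2 u0 im0; field: im2;
  rewrite ?d0 ?u0 ?im0.
Qed.

Lemma J2_unique (b b' : R) (g d g' d' : C) :
    J2 b g d -> J2 b' g' d' -> isomorphic (G2 b g d) (G2 b' g' d') ->
  (b, g, d) = (b', g', d').
Proof.
move=> J J' iso; have [bI _ _ Jmid J1] := J; have [b'I _ _ J'mid J'1] := J'.
have [bb [k [kn k2 kg bd [inv1 inv2]]]] := G2_invariants bI b'I iso.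
subst b'; have [b0|b0] := eqVneq b 0.
  subst b.
  move: inv1 inv2; have -> : rc 0 = 0 :> C by [].
  rewrite expr0n /= subr0 addr0 !mulr1 => inv1 inv2.
  have [t [gE dE dg geq0 tI]] := J2_0 J.
  have [t' [g'E d'E d'g' g'eq0 t'I]] := J2_0 J'.
  have sqE (p q u : C) : (p * u) ^+ 2 + (q * (ii * u)) ^+ 2 = (p ^+ 2 - q ^+ 2)
    * u ^+ 2.
    by ring: mulii.
  have sq_ge0 (x y : C) : `|y| <= `|x| -> `|(`|x| ^+ 2 - `|y| ^+ 2)| = `|x| ^+
    2 - `|y| ^+ 2.
    by move=> yx; rewrite ger0_norm // subr_ge0 lerXn2r // nnegrE.
  (* The quarter-turn offset between [g] and [d] makes $g^2+d^2$ a nonnegative number times a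
     squared phase. Its modulus and [inv1] determine both moduli, and its phase the angle unless the
     moduli agree. *)
  have {}inv2 : (`|g| ^+ 2 - `|d| ^+ 2) * cis t ^+ 2 =
      (`|g'| ^+ 2 - `|d'| ^+ 2) * cis t' ^+ 2.
    by rewrite -!sqE -gE -dE -g'E -d'E.
  have ediff : `|g| ^+ 2 - `|d| ^+ 2 = `|g'| ^+ 2 - `|d'| ^+ 2.
    move/(congr1 Num.norm): (inv2).
    by rewrite !normrM !norm_cis !mulr1 !sq_ge0.
  have ng : `|g| = `|g'|.
    apply/eqP; rewrite -(@eqrXn2 _ 2%N) ?normr_ge0 //; apply/eqP.
    have two0 : (2 : C) != 0 by rewrite pnatr_eq0.
    apply: (mulfI two0).
    transitivity ((`|g| ^+ 2 + `|d| ^+ 2) + (`|g| ^+ 2 - `|d| ^+ 2));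
      first by ring.
    by rewrite inv1 ediff; ring.
  have nd : `|d| = `|d'|.
    apply/eqP; rewrite -(@eqrXn2 _ 2%N) ?normr_ge0 //; apply/eqP.
    by move: inv1; rewrite ng => /addrI.
  suff uE : `|g| != 0 -> cis t = cis t'.
    have [g0|g0] := eqVneq `|g| 0; last first.
      by rewrite gE dE g'E d'E !uE // ng nd.
    have d0 : `|d| = 0 by apply/eqP; rewrite eq_le normr_ge0 -g0 dg.
    have norm0 (x : C) : `|x| = 0 -> x = 0 by move/normr0P/eqP.
    have g'0 : `|g'| = 0 by rewrite -ng g0.
    have d'0 : `|d'| = 0 by rewrite -nd d0.
    rewrite (norm0 _ g0) (norm0 _ d0) (norm0 _ g'0) (norm0 _ d'0). by [].
  (* For equal moduli the squared phase is lost, but [g] and [g'] are nonnegative, so both phases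
     are 1. *)
  move=> g0; have [gd|gd] := eqVneq `|g| `|d|.
    have one (x u : C) : 0 <= x -> `|x| != 0 -> x = `|x| * u -> u = 1.
      move=> x0; rewrite (ger0_norm x0) => xn0 e.
      by apply: (mulfI xn0); rewrite -e mulr1.
    rewrite (one _ _ (geq0 gd) g0 gE) (one _ _ _ _ g'E) -?ng //.
    by apply: g'eq0; rewrite -ng -nd.
  apply: cis_sqr_inj; [exact: tI | by apply: t'I; rewrite -ng -nd|].
  move: inv2; rewrite -ediff; apply: mulfI; rewrite subr_eq0.
  by rewrite eqrXn2.
have rcb0 : rc b != 0 by rewrite (inj_eq (@complexI R) b 0).
have dd : d = d' by apply: (mulfI rcb0).
have kg' : g = k * g' by apply: (mulfI rcb0); rewrite kg; ring.
case/andP: bI => b_ge0 b_le1; have [b1|b1] := eqVneq b 1.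
  by rewrite dd -(ger0_norm (J1 b1)) kg' normrM kn mul1r (ger0_norm (J'1 b1)).
have b01 : 0 < b < 1 by rewrite !lt_neqAle b_ge0 b_le1 b1 eq_sym b0.
have [t tI gt] := Jmid b01; have [t' t'I g't'] := J'mid b01.
congr (_, _, _) => //; apply: (is_arg_opp_eq tI t'I gt g't').
(* For $0<b<1$ the trace of $X^2$ is nonzero, which forces $k=\pm1$; the half-open range of
   arguments then decides the sign. *)
have b2 : 1 - rc b ^+ 2 != 0.
  rewrite subr_eq0 eq_sym -rmorphXn (inj_eq (@complexI R) _ 1).
  by rewrite -[X in _ == X](expr1n R 2) eqrXn2 ?ler01.
have kk : k ^+ 2 = 1 by apply: (mulIf b2); rewrite -k2 mul1r.
by rewrite kg' exprMn kk mul1r.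
Qed.

(** * Rotations of the standard graphs *)

(** The images of the generators may differ from the standard ones by a triangular change of basis,
    invertible since [k] is nonzero. *)
Lemma isomorphic_G2 (f : 'End('M[C]_2)) (X Y : 'M[C]_2) (k m : C) (beta : R)
    (gamma delta : C) :
    star_automorphism f -> (forall x, tau (f x) = tau x) -> k != 0 ->
    f X = k *: pm 0 1 (ii * rc beta) 0 ->
    f Y = m *: pm 0 1 (ii * rc beta) 0 +
      pm 1 (ii * rc beta * gamma) gamma delta ->
  isomorphic <<[:: X; Y]>>%VS (G2 beta gamma delta).
Proof.
move=> fa ft k0 fX fY; exists f; split=> //.
rewrite limg_span /= fX fY G2E; set U := pm 0 _ _ _; set W := pm 1 _ _ _.
apply/vspaceP=> v; apply/mem_span2/mem_span2 => -[x [y ->]].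
  exists (x * k + y * m), y.
  by rewrite scalerDr !scalerA addrA -scalerDl.
exists ((x - y * m) / k), y.
by rewrite scalerDr !scalerA addrA -scalerDl divfK // subrK.
Qed.

(** The third axis is $u\times v$, so the frame is a rotation. For orthogonal $u,v$ the product of
    their Pauli matrices is $i\,u\times v$, which is the relation required of [D]. *)
Lemma frame_rotation (u1 u2 u3 v1 v2 v3 : R) :
    u1 ^+ 2 + u2 ^+ 2 + u3 ^+ 2 = 1 -> v1 ^+ 2 + v2 ^+ 2 + v3 ^+ 2 = 1 ->
    u1 * v1 + u2 * v2 + u3 * v3 = 0 ->
  exists f : 'End('M[C]_2),
  [/\ star_automorphism f, forall x, tau (f x) = tau x
    & forall a b c d, f (pm a b c d) =
      pm a (b * rc u1 + c * rc v1 + d * rc (u2 * v3 - u3 * v2))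
           (b * rc u2 + c * rc v2 + d * rc (u3 * v1 - u1 * v3))
           (b * rc u3 + c * rc v3 + d * rc (u1 * v2 - u2 * v1))].
Proof.
move=> uu vv uv.
have toC (x y z x' y' z' : R) r : x * x' + y * y' + z * z' = r ->
    rc x * rc x' + rc y * rc y' + rc z * rc z' = rc r.
  by move=> <-; rewrite !rmorphD !rmorphM.
have uuC := toC _ _ _ _ _ _ _ uu; have vvC := toC _ _ _ _ _ _ _ vv.
have {uv}uvC := toC _ _ _ _ _ _ _ uv.
rewrite -/(rc 1) in uuC vvC.
have [] := frame_automorphism (A := pm 0 (rc u1) (rc u2) (rc u3))
    (B := pm 0 (rc v1) (rc v2) (rc v3))
    (D := pm 0 (rc (u2 * v3 - u3 * v2)) (rc (u3 * v1 - u1 * v3))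
               (rc (u1 * v2 - u2 * v1))).
- by rewrite adjmx_pm !conj_rc rmorph0.
- by rewrite adjmx_pm !conj_rc rmorph0.
- rewrite mulmx_pm -pm1 mulr0 add0r uuC; congr pm; ring.
- rewrite mulmx_pm -pm1 mulr0 add0r vvC; congr pm; ring.
- rewrite !mulmx_pm -[- pm _ _ _ _]scaleN1r scale_pm mulr0 !add0r uvC.
  by rewrite (mulrC (rc v1)) (mulrC (rc v2)) (mulrC (rc v3)) uvC; congr pm;
    ring.
- rewrite mulmx_pm scale_pm mulr0 add0r uvC !rmorphB !rmorphM /=.
  by congr pm; ring: mulii.
move=> f [fa ft fpm]; exists f; split=> // a b c d.
by rewrite fpm -pm1 !scale_pm !add_pm; congr pm; ring.
Qed.

(* The rotation multiplies the traceless generator by [p - i q] if [b = 1] and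
   by [p] if [q = 0]; in the other cases it does not preserve its line. *)
Lemma G2_rot3 (b : R) (g d : C) (p q : R) : p ^+ 2 + q ^+ 2 = 1 ->
  (b = 1 \/ q = 0) -> isomorphic (G2 b g d) (G2 b (g * Complex p q) d).
Proof.
move=> pq hb.
have [] := @frame_rotation p q 0 (- q) p 0; [by rewrite expr0n addr0 | | by
  ring |].
  by rewrite expr0n addr0 sqrrN addrC.
move=> f [fa ft fpm].
have cE : Complex p q = rc p + ii * rc q := complexE (Complex p q).
have n0 : Complex p (- q) != 0.
  apply/eqP=> -[p0 q0]; move: pq; rewrite p0 expr0n add0r -sqrrN q0 expr0n.
  by move/esym/eqP; rewrite oner_eq0.
have cE' : Complex p (- q) = rc p - ii * rc q.
  by rewrite (complexE (Complex p (- q))) /= rmorphN mulrN.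
rewrite [G2 b g d]G2E; apply: (isomorphic_G2 (m := 0) fa ft n0).
  rewrite fpm scale_pm cE' !rmorphB !rmorphM !rmorphN /= !(rmorph0
    (real_complex R)).
  case: hb => ->; rewrite ?(rmorph1 (real_complex R)) ?(rmorph0 (real_complex
    R));
  congr pm; ring: mulii.
rewrite fpm scale0r add0r cE !rmorphB !rmorphM !rmorphN /= !(rmorph0
  (real_complex R)).
have -> : rc p * rc p - rc q * - rc q = 1.
  by rewrite mulrN opprK -!rmorphM -rmorphD -!expr2 pq.
case: hb => ->; rewrite ?(rmorph1 (real_complex R)) ?(rmorph0 (real_complex R));
congr pm; ring: mulii.
Qed.

(** For $\beta=0$ a rotation about the first axis fixes the traceless generator and rotates
    $(\gamma,\delta)$. *)
Lemma G2_rot1 (g d : C) (p q : R) : p ^+ 2 + q ^+ 2 = 1 ->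
  isomorphic (G2 0 g d) (G2 0 (g * rc p - d * rc q) (g * rc q + d * rc p)).
Proof.
move=> pq; have rc0 : rc 0 = 0 :> C by [].
have [] := @frame_rotation 1 0 0 0 p q; [by ring | by rewrite -pq;
  ring | by ring |].
move=> f [fa ft fpm].
rewrite [G2 0 g d]G2E; apply: (isomorphic_G2 (k := 1) (m := 0) fa ft).
- exact: oner_neq0.
- by rewrite fpm scale1r !rmorphB !rmorphM /= !rc0 (rmorph1 (real_complex R));
  congr pm; ring.
rewrite fpm scale0r add0r !rmorphB !rmorphM /= !rc0 (rmorph1 (real_complex R)).
by congr pm; ring.
Qed.

(** A half turn about the second axis; the sign it puts on the traceless generator does not change
    the span. *)
Lemma G2_flip1 (g d : C) : isomorphic (G2 0 g d) (G2 0 g (- d)).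
Proof.
have rc0 : rc 0 = 0 :> C by [].
have [] := @frame_rotation (-1) 0 0 0 1 0; [by ring | by ring | by ring |].
move=> f [fa ft fpm].
rewrite [G2 0 g d]G2E; apply: (isomorphic_G2 (k := -1) (m := 0) fa ft).
- by rewrite oppr_eq0 oner_neq0.
- rewrite fpm scale_pm !rmorphB !rmorphM !rmorphN /= !rc0 (rmorph1
  (real_complex R)).
  by congr pm; ring.
rewrite fpm scale0r add0r !rmorphB !rmorphM !rmorphN /= !rc0 (rmorph1
  (real_complex R)).
by congr pm; ring.
Qed.

(** * Normalisation of the parameters *)

Lemma isomorphic_refl (S : quantum_graph R) : isomorphic S S.
Proof.
exists \1%VF; split; [|by move=> x; rewrite id_lfunE | exact: lim1g].
split=> [||x y|x]; rewrite ?id_lfunE //.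
by exists id => x; rewrite id_lfunE.
Qed.

(** Applied to $s=x\cdot x$ for a complex vector $x$: nonnegativity of $(lx)\cdot(lx)$ says that the
    real and imaginary parts of $lx$ are orthogonal and the real part is at least as long. *)
Lemma sqr_scale_ge0 (s : C) :
  exists2 l : C, l != 0 & 0 <= l ^+ 2 * s /\ (s != 0 -> 0 < l ^+ 2 * s).
Proof.
have [->|s0] := eqVneq s 0; first by exists 1;
  [exact: oner_neq0 | rewrite mulr0].
exists (sqrtC s^*); first by rewrite sqrtC_eq0 conjC_eq0.
have s_gt0 : 0 < sqrtC s^* ^+ 2 * s.
  by rewrite sqrtCK mulrC -normCK exprn_gt0 // normr_gt0.
by split=> //; apply: ltW.
Qed.

Lemma is_arg_half (z : C) :
  exists2 t : R, 0 <= t < pi & is_arg z t \/ is_arg (- z) t.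
Proof.
have [->|z0] := eqVneq z 0.
  by exists 0; [rewrite lexx pi_gt0 | left; rewrite /is_arg normr0 mul0r].
pose w := z / `|z|.
have zE : z = `|z| * w by rewrite /w mulrC divfK // normr_eq0.
have w1 : Re w ^+ 2 + Im w ^+ 2 = 1.
  apply: (@complexI R); rewrite add_Re2_Im2 /w normrM normfV normr_id.
  by rewrite divff ?normr_eq0 // expr1n.
(* Up to sign the phase lies on the upper half circle without $-1$, where the arccosine of its real
   part is an argument below $\pi$. *)
wlog im0 : z w {z0} zE w1 / (0 <= Im w) && (w != -1).
  move=> H; have [h|] := boolP ((0 <= Im w) && (w != -1)); first exact: (H z w).
  move=> h; have [|||t tI zt] := H (- z) (- w).
  - by rewrite normrN mulrN -zE.
  - by rewrite !raddfN /= !sqrrN.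
  - move: h w1; case: (w) => x y /=; rewrite negb_and negbK -ltNge eq_complex
    /= => h w1.
    case/orP: h => [y0|/andP[/eqP -> /eqP ->]].
      rewrite oppr_ge0 ltW //=; apply/eqP => -[_ y0'].
      by move: y0; rewrite -[y]opprK y0' !oppr0 ltxx.
    rewrite !oppr0 lexx eq_complex /= !oppr0 eqxx andbT opprK.
    by rewrite -subr_eq0 opprK (_ : 1 + 1 = 2%:R) ?pnatr_eq0.
  - by exists t => //; rewrite opprK in zt; case: zt; [right | left].
case/andP: im0 => im0 wN1.
have x1 : -1 <= Re w <= 1.
  rewrite -ler_norml -(@ler_sqr R) ?nnegrE ?ler01 ?normr_ge0 //.
  by rewrite real_normK ?num_real // expr1n -w1 lerDl sqr_ge0.
exists (acos (Re w)).
  rewrite acos_ge0 //= acos_ltpi // (andP x1).2 andbT lt_neqAle (andP x1).1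
    andbT.
  apply: contra wN1 => /eqP e; rewrite eq_complex -e eqxx /=.
  move: w1; rewrite -e sqrrN expr1n => /eqP; rewrite -subr_eq0 addrAC subrr
    add0r sqrf_eq0.
  by rewrite oppr0.
left; rewrite /is_arg acosK ?in_itv //= sin_acos //.
have -> : 1 - Re w ^+ 2 = Im w ^+ 2 by rewrite -w1 addrAC subrr add0r.
rewrite sqrtr_sqr (ger0_norm im0).
by have -> : Complex (Re w) (Im w) = w by case: (w).
Qed.

Lemma conj_phase (g : C) : exists p q : R,
  p ^+ 2 + q ^+ 2 = 1 /\ g * Complex p q = `|g|.
Proof.
have [->|g0] := eqVneq g 0.
  by exists 1, 0; rewrite mul0r normr0 expr1n expr0n addr0.
exists (Re (g^* / `|g|)), (Im (g^* / `|g|)); split.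
  apply: (@complexI R); rewrite add_Re2_Im2 normrM normfV normr_id norm_conjC.
  by rewrite divff ?normr_eq0 // expr1n.
have -> (z : C) : Complex (Re z) (Im z) = z by case: z.
by rewrite mulrA -normCK expr2 mulfK // normr_eq0.
Qed.

(** Converse of [J2_0]: [x] and [y] are the moduli, and a ratio $\pm i$ forces them to be equal. *)
Lemma J2_0_intro (g d x y : C) (t : R) :
    g = x * cis t -> d = y * (ii * cis t) -> 0 <= t < pi -> 0 <= y -> y <= x ->
    (x = y -> 0 <= g) ->
  J2 (0 : R) g d.
Proof.
move=> gE dE tI y0 yx g0.
have ng : `|g| = x by rewrite gE normrM norm_cis mulr1 ger0_norm // (le_trans
  y0).
have nd : `|d| = y by rewrite dE !normrM norm_cis norm_ii !mulr1 ger0_norm.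
have gt : is_arg g t by rewrite /is_arg ng.
have dt : is_arg d (t + pi / 2) by rewrite /is_arg nd cisDpihalf.
split.
- by rewrite lexx ler01.
- by move=> _ _; split; [exists t | rewrite ng nd].
- move=> _ r; have xy : x = y.
    have n1 : `|g / d| = 1 by case: r => ->; rewrite ?normrN norm_ii.
    have d0 : d != 0.
      by apply/eqP => d0; move: n1; rewrite d0 invr0 mulr0 normr0 => /esym/eqP;
        rewrite oner_eq0.
    by rewrite -ng -nd -[g](divfK d0) normrM n1 mul1r.
  split; [exact: g0 | by exists t |].
  by rewrite -(ger0_norm (g0 xy)) ng nd.
- by rewrite ltxx.
- by move/esym/eqP; rewrite oner_eq0.
Qed.

Lemma J2_normal_form0 (g d : C) :
  exists g' d', J2 (0 : R) g' d' /\ isomorphic (G2 0 g d) (G2 0 g' d').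
Proof.
(* An isotropic $(g,d)$ has $d=\pm ig$; a flip fixes the sign, and plane rotations multiply $(g,ig)$
   by arbitrary phases, so [g] becomes its modulus. *)
have [s0|s0] := eqVneq (g ^+ 2 + d ^+ 2) 0.
  have [h [hd iso]] : exists h, h = ii * g /\ isomorphic (G2 0 g d) (G2 0 g h).
    have : d ^+ 2 == (ii * g) ^+ 2.
      rewrite -subr_eq0 -s0; apply/eqP; ring: mulii.
    rewrite eqf_sqr => /orP[]/eqP ->.
      by exists (ii * g); split=> //; apply: isomorphic_refl.
    by exists (ii * g); split=> //; have := G2_flip1 g (- (ii * g));
      rewrite opprK.
  have [p [q [pq gpq]]] := conj_phase g.
  exists `|g|, (`|g| * ii); split.
    apply: (@J2_0_intro _ _ `|g| `|g| 0); rewrite ?cos0 ?sin0.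
    - by rewrite -[Complex 1 0]/(1 : C) mulr1.
    - by rewrite -[Complex 1 0]/(1 : C) mulr1.
    - by rewrite lexx pi_gt0.
    - exact: normr_ge0.
    - exact: lexx.
    - by rewrite normr_ge0.
  apply: (isomorphic_trans iso).
  have pq' : p ^+ 2 + (- q) ^+ 2 = 1 by rewrite sqrrN.
  have := G2_rot1 g h pq'; rewrite hd rmorphN /= -gpq (complexE (Complex p q))
    /=.
  have -> : g * rc p - ii * g * - rc q = g * (rc p + ii * rc q) by ring.
  have -> // : g * - rc q + ii * g * rc p = g * (rc p + ii * rc q) * ii.
  by ring: mulii.
(* After multiplication by [l] the vector [(g, d)] has orthogonal real and
   imaginary parts [(a1, a2)] and [(b1, b2)]; the real part, the longer one, is
   rotated to the first axis. *)
have [l l0 [_ /(_ s0) ls]] := sqr_scale_ge0 (g ^+ 2 + d ^+ 2).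
case lgE : (l * g) => [a1 b1]; case ldE : (l * d) => [a2 b2].
have [ab pos] : a1 * b1 + a2 * b2 = 0 /\ b1 ^+ 2 + b2 ^+ 2 < a1 ^+ 2 + a2 ^+ 2.
  move: ls; have -> : l ^+ 2 * (g ^+ 2 + d ^+ 2) = (l * g) ^+ 2 + (l * d) ^+ 2
    by ring.
  rewrite lgE ldE ltcE /= => /andP[/eqP e h]; split; last by lra.
  by move: e; lra.
pose n := Num.sqrt (a1 ^+ 2 + a2 ^+ 2).
have n2 : n ^+ 2 = a1 ^+ 2 + a2 ^+ 2 by rewrite sqr_sqrtr // addr_ge0 ?sqr_ge0.
have n0 : 0 < n.
  by rewrite sqrtr_gt0; apply: le_lt_trans pos; rewrite addr_ge0 ?sqr_ge0.
have pq : (a1 / n) ^+ 2 + (- a2 / n) ^+ 2 = 1.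
  by rewrite !exprMn sqrrN -mulrDl -n2 exprVn divff // expf_neq0 // gt_eqF.
have iso1 := G2_rot1 g d pq.
(* The signed length of the imaginary part, which the rotation puts on the second axis of the plane;
   orthogonality and the Lagrange identity give $m^2=b_1^2+b_2^2$. *)
pose m := (a1 * b2 - a2 * b1) / n.
have mn : `|m| < n.
  rewrite -ltr_sqr ?nnegrE ?normr_ge0 ?ltW // real_normK ?num_real //.
  have -> : m ^+ 2 = b1 ^+ 2 + b2 ^+ 2; last by rewrite n2.
  rewrite /m exprMn exprVn n2; apply: (mulIf (x := a1 ^+ 2 + a2 ^+ 2)).
    by rewrite -n2 expf_neq0 // gt_eqF.
  rewrite divfK -?n2 ?expf_neq0 ?gt_eqF // n2.
  have -> : (a1 * b2 - a2 * b1) ^+ 2 = (b1 ^+ 2 + b2 ^+ 2) * (a1 ^+ 2 + a2 ^+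
    2) - (a1 * b1 + a2 * b2) ^+ 2 by ring.
  by rewrite ab expr0n subr0.
have gE : g * rc (a1 / n) - d * rc (- a2 / n) = l^-1 * rc n.
  apply: (mulfI l0); rewrite mulrA divff // mul1r mulrBr !mulrA lgE ldE.
  apply/eqP; rewrite eq_complex /=; apply/andP; split; apply/eqP.
    rewrite !mulr0 !subr0 mulNr mulrN opprK !mulrA -mulrDl -!expr2 -n2 expr2
      mulfK //.
    by rewrite gt_eqF.
  by rewrite !mulr0 !add0r mulNr mulrN opprK !mulrA -mulrDl [b1 * _]mulrC [b2 *
    _]mulrC ab mul0r.
have dE : g * rc (- a2 / n) + d * rc (a1 / n) = l^-1 * (ii * rc m).
  apply: (mulfI l0); rewrite mulrA divff // mul1r mulrDr !mulrA lgE ldE.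
  apply/eqP; rewrite eq_complex /=; apply/andP; split; apply/eqP; rewrite /m;
    ring.
rewrite gE dE in iso1.
have [t tI ht] := is_arg_half l^-1.
(* The sign [e] brings the common phase into $[0,\pi)$; it is realised by the rotation with $p=e$,
   $q=0$. *)
have [e [e1 et]] : exists e : R, e ^+ 2 = 1 /\ l^-1 * rc e = `|l^-1| * cis t.
  case: ht => ht; [exists 1|exists (-1)]; rewrite ?sqrrN expr1n; split=> //.
    by rewrite (rmorph1 (real_complex R)) mulr1.
  by rewrite rmorphN (rmorph1 (real_complex R)) mulrN1 -[in RHS]normrN.
have ee : e ^+ 2 + 0 ^+ 2 = 1 by rewrite expr0n addr0.
have iso2 := isomorphic_trans iso1 (G2_rot1 _ _ ee).
have rc0 : rc 0 = 0 :> C by [].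
rewrite rc0 !mulr0 subr0 add0r in iso2.
have gE2 : l^-1 * rc n * rc e = `|l^-1| * rc n * cis t.
  by rewrite mulrAC et mulrAC.
have dE2 : l^-1 * (ii * rc m) * rc e = `|l^-1| * rc m * (ii * cis t).
  by rewrite mulrAC et; ring.
rewrite gE2 dE2 in iso2.
have [h [hE iso3]] : exists h, h = `|l^-1| * rc `|m| * (ii * cis t) /\
    isomorphic (G2 0 g d) (G2 0 (`|l^-1| * rc n * cis t) h).
  exists (`|l^-1| * rc `|m| * (ii * cis t)); split=> //.
  have [m0|m0] := leP 0 m; first by rewrite (ger0_norm m0).
  rewrite (ltr0_norm m0) rmorphN mulrN mulNr.
  by apply: (isomorphic_trans iso2); apply: G2_flip1.
have ll : 0 < `|l^-1| by rewrite normr_gt0 invr_eq0.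
exists (`|l^-1| * rc n * cis t), h; split=> //.
apply: (@J2_0_intro _ _ (`|l^-1| * rc n) (`|l^-1| * rc `|m|) t) => //.
- by rewrite mulr_ge0 // ?normr_ge0 // ler0c normr_ge0.
- by rewrite ler_pM2l // lecR ltW.
(* Equal moduli are impossible here, since $|m|<n$ strictly. *)
- move/(mulfI (lt0r_neq0 ll))/complexI => nm; by move: mn; rewrite -nm ltxx.
Qed.

Lemma J2_normal_form (b : R) (g d : C) : 0 <= b <= 1 ->
  exists g' d', J2 b g' d' /\ isomorphic (G2 b g d) (G2 b g' d').
Proof.
move=> bI; have [->|b0] := eqVneq b 0; first exact: J2_normal_form0.
have [b1|b1] := eqVneq b 1.
  have [p [q [pq gpq]]] := conj_phase g; exists `|g|, d; split.
    split=> [||||_]; [exact: bI | by move/eqP; rewrite (negPf b0)..| |].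
      by rewrite b1 ltxx andbF.
    exact: normr_ge0.
  by rewrite -gpq; apply: G2_rot3; [|left].
have J g' t : 0 <= t < pi -> is_arg g' t -> J2 b g' d.
  move=> tI g't; split; [exact: bI | by move/eqP; rewrite (negPf b0)..| |].
    by exists t.
  by move/eqP; rewrite (negPf b1).
have [t tI [gt|gt]] := is_arg_half g.
  by exists g, d; split; [exact: J gt | exact: isomorphic_refl].
exists (- g), d; split; first exact: J gt.
(* The half turn about the third axis, available for every [b]. *)
have -> : - g = g * Complex (-1) 0.
  by rewrite (complexE (Complex (-1) 0)) /= rmorphN (rmorph1 (real_complex R))
    rmorph0 mulr0 addr0 mulrN1.
by apply: G2_rot3; [rewrite sqrrN expr1n expr0n addr0 | right].
Qed.

(** * Reduction to a standard graph *)

Lemma exists_orthogonal_unit (u1 u2 u3 : R) : u1 ^+ 2 + u2 ^+ 2 + u3 ^+ 2 = 1 ->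
  exists v1 v2 v3 : R,
    v1 ^+ 2 + v2 ^+ 2 + v3 ^+ 2 = 1 /\ u1 * v1 + u2 * v2 + u3 * v3 = 0.
Proof.
(* On the third axis the first basis vector serves; otherwise the normalised horizontal projection
   is turned by a right angle. *)
move=> uu; have [s0|s0] := eqVneq (u1 ^+ 2 + u2 ^+ 2) 0.
  move/eqP: s0; rewrite paddr_eq0 ?sqr_ge0 // !sqrf_eq0 => /andP[/eqP-> /eqP->].
  by exists 1, 0, 0; split; ring.
pose n := Num.sqrt (u1 ^+ 2 + u2 ^+ 2).
have n2 : n ^+ 2 = u1 ^+ 2 + u2 ^+ 2 by rewrite sqr_sqrtr // addr_ge0 ?sqr_ge0.
exists (- u2 / n), (u1 / n), 0; split; last by ring.
by rewrite !exprMn sqrrN expr0n addr0 -mulrDl [_ + u1 ^+ 2]addrC -n2 exprVn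
  divff // n2.
Qed.

Lemma traceless_frame (x1 x2 x3 : C) : pm 0 x1 x2 x3 != 0 ->
  exists (f : 'End('M[C]_2)) (k : C) (b : R),
  [/\ star_automorphism f, forall x, tau (f x) = tau x, k != 0, 0 <= b <= 1
    & f (k *: pm 0 1 (ii * rc b) 0) = pm 0 x1 x2 x3].
Proof.
move=> X0.
have [l l0 [ls _]] := sqr_scale_ge0 (x1 ^+ 2 + x2 ^+ 2 + x3 ^+ 2).
case e1 : (l * x1) => [a1 b1]; case e2 : (l * x2) => [a2 b2].
case e3 : (l * x3) => [a3 b3].
have [ab le] : a1 * b1 + a2 * b2 + a3 * b3 = 0 /\
    b1 ^+ 2 + b2 ^+ 2 + b3 ^+ 2 <= a1 ^+ 2 + a2 ^+ 2 + a3 ^+ 2.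
  move: ls; have -> : l ^+ 2 * (x1 ^+ 2 + x2 ^+ 2 + x3 ^+ 2) =
      (l * x1) ^+ 2 + (l * x2) ^+ 2 + (l * x3) ^+ 2 by ring.
  rewrite e1 e2 e3 lecE /= => /andP[/eqP e h]; split; last by lra.
  by move: e; lra.
pose n := Num.sqrt (a1 ^+ 2 + a2 ^+ 2 + a3 ^+ 2).
pose m := Num.sqrt (b1 ^+ 2 + b2 ^+ 2 + b3 ^+ 2).
have n2 : n ^+ 2 = a1 ^+ 2 + a2 ^+ 2 + a3 ^+ 2.
  by rewrite sqr_sqrtr // !addr_ge0 ?sqr_ge0.
have m2 : m ^+ 2 = b1 ^+ 2 + b2 ^+ 2 + b3 ^+ 2.
  by rewrite sqr_sqrtr // !addr_ge0 ?sqr_ge0.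
have sum0 (x y z : R) : x ^+ 2 + y ^+ 2 + z ^+ 2 = 0 -> [/\ x = 0, y = 0 & z =
  0].
  move/eqP; rewrite !paddr_eq0 ?addr_ge0 ?sqr_ge0 // !sqrf_eq0.
  by move=> /andP[/andP[/eqP -> /eqP ->] /eqP ->].
have m0 : 0 <= m := sqrtr_ge0 _.
have mn : m <= n by rewrite ler_sqrt // !addr_ge0 ?sqr_ge0.
have n0 : 0 < n.
  rewrite lt_neqAle eq_sym sqrtr_ge0 andbT; apply/eqP => n0.
  have mz : m = 0 by apply/eqP; rewrite eq_le m0 -n0 mn.
  move: n2; rewrite n0 expr0n => /esym/sum0[a10 a20 a30].
  move: m2; rewrite mz expr0n => /esym/sum0[b10 b20 b30].
  have z0 (x : C) : l * x = Complex 0 0 -> x = 0.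
    by move/eqP; rewrite -[Complex 0 0]/(0 : C) mulf_eq0 (negPf l0) => /eqP.
  case/eqP: X0; rewrite (z0 x1) ?e1 ?a10 ?b10 // (z0 x2) ?e2 ?a20 ?b20 //.
  rewrite (z0 x3) ?e3 ?a30 ?b30 // pmE.
  by apply/matrixP => -[[|[|//]] ?] [[|[|//]] ?]; rewrite !mxE /=; ring.
have nn0 : n != 0 by rewrite gt_eqF.
have uu : (a1 / n) ^+ 2 + (a2 / n) ^+ 2 + (a3 / n) ^+ 2 = 1.
  by rewrite !exprMn -!mulrDl -n2 exprVn divff // expf_neq0.
(* The direction of the imaginary part, or any unit vector orthogonal to the real part if the
   imaginary part vanishes. *)
have [v1 [v2 [v3 [vv uv bv1 bv2 bv3]]]] : exists v1 v2 v3 : R,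
    [/\ v1 ^+ 2 + v2 ^+ 2 + v3 ^+ 2 = 1,
        a1 / n * v1 + a2 / n * v2 + a3 / n * v3 = 0,
        b1 = m * v1, b2 = m * v2 & b3 = m * v3].
  have [mz|mz] := eqVneq m 0.
    have [v1 [v2 [v3 [vv uv]]]] := exists_orthogonal_unit uu; exists v1, v2, v3.
    move: m2; rewrite mz expr0n => /esym/sum0[-> -> ->].
    by rewrite !mul0r.
  exists (b1 / m), (b2 / m), (b3 / m); split; try by rewrite mulrC divfK.
    by rewrite !exprMn -!mulrDl -m2 exprVn divff // expf_neq0.
  transitivity ((a1 * b1 + a2 * b2 + a3 * b3) / n / m); first by ring.
  by rewrite ab !mul0r.
have [f [fa ft fpm]] := frame_rotation uu vv uv.
(* With $u=a/n$ and $b=mv$ the scaled vector is $lx=n(u+i\frac mn v)$, so $\beta$ is the ratio of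
   the two lengths. *)
exists f, (rc n / l), (m / n); split=> //.
- by rewrite mulf_neq0 ?invr_eq0 // (inj_eq (@complexI R) n 0).
- by rewrite ler_pdivrMr // mul1r mn andbT divr_ge0 // ltW.
have rcn0 : rc n != 0 by rewrite (inj_eq (@complexI R) n 0).
have coord (x : C) (a b v : R) : l * x = Complex a b -> b = m * v ->
    rc n / l * (1 * rc (a / n) + ii * rc (m / n) * rc v + 0) = x.
  move=> lx bv; apply: (mulfI l0); rewrite lx (complexE (Complex a b)) /= bv
    addr0 mul1r.
  rewrite !rmorphM !fmorphV /=; move: (rc n) (rc a) (rc m) (rc v) rcn0 => N A M
    V N0.
  by field; rewrite N0 l0.
rewrite linearZ /= fpm scale_pm mulr0 !mul0r.
by rewrite (coord x1 a1 b1 v1) // (coord x2 a2 b2 v2) // (coord x3 a3 b3 v3).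
Qed.

Lemma isomorphic_G2_of_pair (x1 x2 x3 y1 y2 y3 : C) : pm 0 x1 x2 x3 != 0 ->
  exists b g d, 0 <= b <= 1 /\
    isomorphic <<[:: pm 0 x1 x2 x3; pm 1 y1 y2 y3]%R>>%VS (G2 b g d).
Proof.
move=> /traceless_frame[f [k [b [fa ft k0 bI fX]]]].
have [ga gt fK _] := isomorphism_inv fa ft.
have [z0 [z1 [z2 [z3 gY]]]] := pm_surj (f^-1%VF (pm 1 y1 y2 y3)).
have z0E : z0 = 1.
  have two0 : (2 : C) != 0 by rewrite pnatr_eq0.
  have := tau_mxtrace (gt (pm 1 y1 y2 y3)).
  by rewrite gY !mxtrace_pm => /(mulfI two0).
(* [c] is chosen so that subtracting [c] times the traceless generator makes the
   second generator orthogonal to it. *)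
pose c := (z1 - ii * rc b * z2) / (1 + rc b * rc b).
exists b, (z2 - c * (ii * rc b)), z3; split=> //.
apply: (isomorphic_G2 (m := c) ga gt k0); first by rewrite -fX fK.
rewrite gY z0E scale_pm add_pm.
have cE : c * (1 + rc b * rc b) = z1 - ii * rc b * z2 by rewrite divfK //
  real_sqr1_neq0.
have -> : z1 = c * (1 + rc b * rc b) + ii * rc b * z2 by rewrite cE subrK.
by congr pm; ring: mulii.
Qed.

(** An element not orthogonal to the identity scales to identity coefficient 1; subtracting a
    multiple of it makes an independent second element traceless. *)
Lemma nonloopfree_basis (G : quantum_graph R) :
  ~ loopfree G -> num_edges G = 2%N ->
  exists x1 x2 x3 y1 y2 y3 : C, pm 0 x1 x2 x3 != 0 /\
    G = <<[:: pm 0 x1 x2 x3; pm 1 y1 y2 y3]%R>>%VS.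
Proof.
move=> /existsNP[x /not_implyP[xG tx]] dimG.
have [a [y1 [y2 [y3 xE]]]] := pm_surj x.
have a0 : a != 0.
  apply/eqP => a0; apply: tx; rewrite /inner trmx1 map_mx1 mul1mx xE mxtrace_pm.
  by rewrite a0 !mulr0.
have {}xE : a^-1 *: x = pm 1 (a^-1 * y1) (a^-1 * y2) (a^-1 * y3).
  by rewrite xE scale_pm mulVf.
have : pm 1 (a^-1 * y1) (a^-1 * y2) (a^-1 * y3) \in G by rewrite -xE memvZ.
move: (a^-1 * y1) (a^-1 * y2) (a^-1 * y3) => {y1 y2 y3 xE} y1 y2 y3.
set Y := pm 1 y1 y2 y3 => YG.
have /subvPn[z zG zY] : ~~ (G <= <[Y]>)%VS.
  apply/negP => /dimvS; rewrite -[\dim G]/(num_edges G) dimG dim_vline.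
  by case: (_ != 0).
have [w0 [w1 [w2 [w3 zE]]]] := pm_surj z.
have XE : z - w0 *: Y = pm 0 (w1 - w0 * y1) (w2 - w0 * y2) (w3 - w0 * y3).
  rewrite zE /Y scale_pm -scaleN1r scale_pm add_pm; congr pm; ring.
exists (w1 - w0 * y1), (w2 - w0 * y2), (w3 - w0 * y3), y1, y2, y3.
rewrite -XE; set X := z - _.
have XG : X \in G by rewrite memvB // memvZ.
have XY : X \notin <[Y]>%VS.
  apply: contra zY => XY; rewrite -[z](subrK (w0 *: Y)) memvD // memvZ //.
  exact: memv_line.
split; first by apply: contraNneq XY => ->; rewrite mem0v.
apply/esym/eqP; rewrite eqEdim; apply/andP; split.
  by apply/span_subvP => v; rewrite !inE => /orP[]/eqP ->.
(* If the span had dimension at most one it would be the line of [Y], which does not contain [X]. *)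
rewrite -[\dim G]/(num_edges G) dimG ltnNge; apply/negP => le1.
case/negP: XY; suff /eqP <- : <<[:: X; Y]>>%VS == <[Y]>%VS.
  by apply: memv_span; rewrite inE eqxx.
rewrite eq_sym eqEdim; apply/andP; split.
  by rewrite -memvE memv_span // !inE eqxx orbT.
rewrite (leq_trans le1) // dim_vline lt0n eqb0 negbK.
apply/eqP => Y0; have := mxtrace_pm 1 y1 y2 y3;
  rewrite -/Y Y0 linear0 => /esym/eqP.
by rewrite mulr1 pnatr_eq0.
Qed.

Lemma nonloopfree_J2 (G : quantum_graph R) :
  ~ loopfree G -> num_edges G = 2%N ->
  exists b g d, J2 b g d /\ isomorphic G (G2 b g d).
Proof.
move=> nl dG; have [x1 [x2 [x3 [y1 [y2 [y3 [X0 ->]]]]]]] := nonloopfree_basis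
  nl dG.
have [b [g [d [bI iso]]]] := isomorphic_G2_of_pair y1 y2 y3 X0.
have [g' [d' [J iso']]] := J2_normal_form g d bI.
by exists b, g', d'; split=> //; apply: isomorphic_trans iso'.
Qed.

End Pauli.

Theorem theorem6p2 (R : realType) (G : quantum_graph R) :
  ~ loopfree G -> num_edges G = 2 ->
  exists! p : R * R[i] * R[i],
    J2 p.1.1 p.1.2 p.2 /\ isomorphic G (G2 p.1.1 p.1.2 p.2).
Proof.
move=> nl dG; have [b [g [d [J iso]]]] := nonloopfree_J2 nl dG.
exists (b, g, d); split=> // -[[b' g'] d'] [J' iso'].
apply: J2_unique J J' _; exact: isomorphic_trans (isomorphic_sym iso) iso'.
Qed.
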